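(* Let $G$ be a finitely presented group that is one-ended. Then $\operatorname{asdim} G \geq 2$.
   Context: Cayley graph: for a group $G$ with generating set $S$, the Cayley graph is the 1-dimensional complex with a vertex for each element of $G$ and an edge joining $x$ to $xs$ for every $x \in G$ and $s \in S$. It is a geodesic metric space with the path metric in which each edge has length $1$. A finitely generated group $G$ is regarded as a metric space via its Cayley graph with respect to a finite generating set; one-endedness and asymptotic dimension of $G$ mean those of this metric space (they are invariant under quasi-isometry, so they do not depend on the finite generating set). One-ended: a geodesic metric space $X$ is one-ended if for every bounded $K \subset X$, $X - K$ has exactly one unbounded connected component. Asymptotic dimension: for subsets $A,B$ of a metric space $(X,d)$ put $d(A,B)=\inf\{d(a,b): a\in A, b\in B\}$. For a real number $d>0$, a metric space $Y$ is $d$-disconnected if there are subsets $B_i \subset Y$ ($i \in I$) with $Y = \bigcup_{i \in I} B_i$, $\sup\{\operatorname{diam} B_i : i \in I\} < \infty$, and $d(B_i,B_j) \geq d$ for all $i \neq j$. Then $\operatorname{asdim} X = n$ if $n$ is the minimal non-negative integer such that for every $d>0$ one can write $X = \bigcup_{k=0}^{n} X_k$ with all $X_k$ $d$-disconnected; if no such $n$ exists, $\operatorname{asdim} X = \infty$. *)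

(* Defs.v *)
From HB Require Import structures.
From mathcomp Require Import all_boot all_order all_algebra finmap.
From mathcomp Require Import all_classical all_reals.
From mathcomp Require Import ereal topology.
From mathcomp Require Import lra.

Set Implicit Arguments.
Unset Strict Implicit.
Unset Printing Implicit Defensive.

Import Order.TTheory GRing.Theory Num.Theory.

Local Open Scope classical_set_scope.
Local Open Scope ring_scope.

(* The letter (a, false) stands for a and (a, true) for the inverse of a. *)
Definition word (I : Type) := seq (I * bool).

Definition word_eval (G : groupType) (I : Type) (f : I -> G) (w : word I) : G :=
  (\prod_(a <- w) (if a.2 then (f a.1)^-1 else f a.1))%g.

Definition generates (G : groupType) (I : Type) (f : I -> G) :=
  forall g, exists w, word_eval f w = g.

(* The congruence on words whose quotient is the group < I | rels >. *)
Inductive presentation_eq (I : eqType) (rels : seq (word I)) :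
    word I -> word I -> Prop :=
| PEq_refl u : presentation_eq rels u u
| PEq_sym u v : presentation_eq rels u v -> presentation_eq rels v u
| PEq_trans u v w :
    presentation_eq rels u v -> presentation_eq rels v w ->
    presentation_eq rels u w
| PEq_cat u u' v v' :
    presentation_eq rels u u' -> presentation_eq rels v v' ->
    presentation_eq rels (u ++ v) (u' ++ v')
| PEq_cancel a b : presentation_eq rels [:: (a, b); (a, ~~ b)] [::]
| PEq_rel r : r \in rels -> presentation_eq rels r [::].

Definition finitely_presented (G : groupType) :=
  exists (n : nat) (f : 'I_n -> G) (rels : seq (word 'I_n)),
    generates f /\
    forall u v, word_eval f u = word_eval f v <-> presentation_eq rels u v.

Section metric_notions.
Context {R : realType} {X : metricType R}.
Implicit Types A B K Y : set X.

(* The diameter of the empty set is -oo; this plays no role below, where only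
   upper bounds on diameters matter. *)
Definition diam A : \bar R :=
  ereal_sup [set (mdist p.1 p.2)%:E | p in A `*` A].

Definition set_dist A B : \bar R :=
  ereal_inf [set (mdist p.1 p.2)%:E | p in A `*` B].

Definition metric_bounded A := (diam A < +oo)%E.

Definition d_disconnected (d : R) Y :=
  exists (I : Type) (B : I -> set X),
    [/\ Y = \bigcup_i B i,
        (ereal_sup (range (fun i => diam (B i))) < +oo)%E &
        forall i j, i <> j -> (d%:E <= set_dist (B i) (B j))%E].

End metric_notions.

Section one_ended_asdim.
Context {R : realType} (X : metricType R).

Definition one_ended :=
  forall K : set X, metric_bounded K ->
    exists! C : set X,
      (connected_component (~` K) @` (~` K)) C /\ ~ metric_bounded C.

Definition asdim_cover (n : nat) :=
  forall d : R, 0 < d ->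
    exists Y : 'I_n.+1 -> set X,
      [set: X] = \bigcup_k Y k /\ forall k, d_disconnected d (Y k).

Definition asdim : \bar R :=
  if pselect (exists n, `[< asdim_cover n >]) is left h
  then (ex_minn h)%:R%:E else +oo%E.

End one_ended_asdim.

(* The underlying set of the 1-complex: the vertices, and for every
   (x, s) in G * S an open unit interval attached to x (parameter 0) and
   to x s (parameter 1). *)
Inductive cayley_point (R : realType) (G : groupType) (S : {fset G}) :=
| Vertex of G
| Interior of G & S & {t : R | 0 < t < 1}.

Section cayley.
Context (R : realType) (G : groupType) (S : {fset G}).
Local Notation point := (cayley_point R S).

(* The characteristic map [0, 1] -> point of the closed edge (x, s). *)
Definition edge_point (x : G) (s : S) (t : R) : point :=
  if insub t is Some u then Interior x s u
  else if t <= 0 then Vertex R S x else Vertex R S (x * val s)%g.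

(* [edge_path p q l]: there is a piecewise linear path of length l from p to q,
   each of its pieces being contained in a closed edge. *)
Inductive edge_path : point -> point -> R -> Prop :=
| EPath_nil p : edge_path p p 0
| EPath_cons x s t u q l :
    0 <= t <= 1 -> 0 <= u <= 1 -> edge_path (edge_point x s u) q l ->
    edge_path (edge_point x s t) q (`|u - t| + l).

Definition path_dist (p q : point) : R := inf [set l | edge_path p q l].

Lemma edge_point0 x s : edge_point x s 0 = Vertex R S x.
Proof. by rewrite /edge_point insubN ?lexx// ltxx. Qed.

Lemma edge_point1 x s : edge_point x s 1 = Vertex R S (x * val s)%g.
Proof. by rewrite /edge_point insubN ?ltxx ?andbF// ler10. Qed.

Lemma edge_point_in x s (t : {t : R | 0 < t < 1}) :
  edge_point x s (val t) = Interior x s t.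
Proof. by rewrite /edge_point valK. Qed.

Lemma edge_pointP x s (t : R) : 0 <= t <= 1 ->
  [\/ t = 0 /\ edge_point x s t = Vertex R S x,
      t = 1 /\ edge_point x s t = Vertex R S (x * val s)%g |
      exists2 u, t = val u & edge_point x s t = Interior x s u].
Proof.
move=> /andP[t0 t1].
have [->|tn0] := eqVneq t 0; first by apply: Or31; rewrite edge_point0.
have [->|tn1] := eqVneq t 1; first by apply: Or32; rewrite edge_point1.
have t01 : 0 < t < 1 by rewrite !lt_neqAle eq_sym tn0 tn1 t0 t1.
by apply: Or33; exists (Sub t t01); rewrite // -edge_point_in.
Qed.

Lemma edge_path_ge0 p q l : edge_path p q l -> 0 <= l.
Proof. by elim=> // *; rewrite addr_ge0. Qed.

Lemma edge_path_cat p q r l m :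
  edge_path p q l -> edge_path q r m -> edge_path p r (l + m).
Proof.
move=> pq; elim: pq r m => [p' r m|x s t u q' l' t01 u01 _ IH r m qr].
  by rewrite add0r.
by rewrite -addrA; apply: EPath_cons => //; apply: IH.
Qed.

Lemma edge_path1 x s (t u : R) : 0 <= t <= 1 -> 0 <= u <= 1 ->
  edge_path (edge_point x s t) (edge_point x s u) `|u - t|.
Proof. by move=> ? ?; rewrite -[X in edge_path _ _ X]addr0; do 2?constructor. Qed.

Lemma edge_path_sym p q l : edge_path p q l -> edge_path q p l.
Proof.
elim=> [p'|x s t u q' l' t01 u01 _ IH]; first by constructor.
by rewrite addrC distrC; apply: (edge_path_cat IH); apply: edge_path1.
Qed.

Lemma edge_path_letter g (a : S * bool) :
  edge_path (Vertex R S g)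
    (Vertex R S (g * (if a.2 then (val a.1)^-1 else val a.1))%g) 1.
Proof.
have E x (s : S) : edge_path (Vertex R S x) (Vertex R S (x * val s)%g) 1.
  rewrite -(edge_point0 x s) -(edge_point1 x s).
  have := @edge_path1 x s 0 1; rewrite subr0 normr1.
  by apply; rewrite ?lexx ?ler01.
case: a => s [] /=; last exact: E.
by apply: edge_path_sym; have := E (g * (val s)^-1)%g s; rewrite mulgVK.
Qed.

Lemma edge_path_word g (w : word S) :
  exists l, edge_path (Vertex R S g) (Vertex R S (g * word_eval val w)%g) l.
Proof.
elim: w g => [|a w IH] g.
  by exists 0; rewrite /word_eval big_nil mulg1; constructor.
have [l gl] := IH (g * (if a.2 then (val a.1)^-1 else val a.1))%g.
exists (1 + l); rewrite /word_eval big_cons mulgA.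
exact: edge_path_cat (edge_path_letter g a) gl.
Qed.

Lemma edge_path_vertex p : exists g l, edge_path p (Vertex R S g) l.
Proof.
case: p => [g|x s t]; first by exists g, 0; constructor.
exists x, `|0 - val t|; rewrite -edge_point_in -(edge_point0 x s).
case/andP: (valP t) => t0 t1.
by apply: edge_path1; rewrite ?lexx ?ler01// !ltW.
Qed.

Lemma edge_path_connected (genS : generates (val : S -> G)) p q :
  exists l, edge_path p q l.
Proof.
have [g [l pg]] := edge_path_vertex p.
have [h [m qh]] := edge_path_vertex q.
have [w wE] := genS (g^-1 * h)%g.
have [k gh] := edge_path_word g w.
rewrite wE mulVKg in gh.
exists (l + (k + m)); apply: (edge_path_cat pg).
exact: edge_path_cat gh (edge_path_sym qh).
Qed.

Lemma path_dist_le p q l : edge_path p q l -> path_dist p q <= l.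
Proof.
move=> pq; apply: ge_inf => //.
by exists 0 => m /edge_path_ge0.
Qed.

Lemma path_dist_ge (genS : generates (val : S -> G)) p q (c : R) :
  (forall l, edge_path p q l -> c <= l) -> c <= path_dist p q.
Proof. by move=> h; apply: lb_le_inf => //; exact: edge_path_connected. Qed.

Lemma path_dist_lip (genS : generates (val : S -> G)) (f : point -> R) :
  (forall x s t u, 0 <= t <= 1 -> 0 <= u <= 1 ->
     f (edge_point x s u) - f (edge_point x s t) <= `|u - t|) ->
  forall p q, f q - f p <= path_dist p q.
Proof.
move=> flip p q; apply: path_dist_ge => // l.
elim=> [p'|x s t u q' l' t01 u01 _ IH]; first by rewrite subrr.
by have := flip x s t u t01 u01; lra.
Qed.

Lemma path_distxx p : path_dist p p = 0.
Proof.
apply/eqP; rewrite eq_le; apply/andP; split.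
  by apply: path_dist_le; constructor.
apply: lb_le_inf; first by exists 0; constructor.
by move=> l /edge_path_ge0.
Qed.

Lemma path_dist_sym p q : path_dist p q = path_dist q p.
Proof.
by congr inf; apply/seteqP; split=> l /edge_path_sym.
Qed.

Lemma path_dist_triangle (genS : generates (val : S -> G)) q p r :
  path_dist p r <= path_dist p q + path_dist q r.
Proof.
rewrite -lerBlDr; apply: path_dist_ge => // l pq.
rewrite lerBlDr addrC -lerBlDr; apply: path_dist_ge => // m qr.
rewrite lerBlDr addrC; apply: path_dist_le; exact: edge_path_cat pq qr.
Qed.

(* Truncated distance to a vertex, resp. to an interior point. *)
Let vdist (v : G) (p : point) : R :=
  match p with
  | Vertex y => (y != v)%:R
  | Interior y s u =>
      Num.min (if y == v then val u else 1)
              (if (y * val s)%g == v then 1 - val u else 1)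
  end.

Let idist (x : G) (s : S) (t : R) (p : point) : R :=
  let r := Num.min t (1 - t) in
  match p with
  | Vertex _ => r
  | Interior y a u =>
      if (y == x) && (a == s) then Num.min `|val u - t| r else r
  end.

Let vdistE v y s (u : R) : 0 <= u <= 1 ->
  vdist v (edge_point y s u) =
  Num.min (if y == v then u else 1) (if (y * val s)%g == v then 1 - u else 1).
Proof.
move=> u01; have [[-> ->]|[-> ->]|[w -> ->]] := edge_pointP y s u01 => //=.
  by case: eqP => _; rewrite subr0 if_same minEle ?ler01 ?lexx.
by case: eqP => _; rewrite if_same ?subrr minEle ?lexx ?ler10.
Qed.

Let idistE x s (t : R) y a (u : R) : 0 < t < 1 -> 0 <= u <= 1 ->
  idist x s t (edge_point y a u) =
  if (y == x) && (a == s) then Num.min `|u - t| (Num.min t (1 - t))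
  else Num.min t (1 - t).
Proof.
move=> /andP[t0 t1] u01.
have [[-> ->]|[-> ->]|[w -> ->]] := edge_pointP y a u01 => //=;
  case: ifP => // _; symmetry; apply/min_idPr.
  by rewrite sub0r normrN gtr0_norm// ge_min lexx.
by rewrite gtr0_norm ?subr_gt0// ge_min lexx orbT.
Qed.

Let min_lip (a b a' b' c : R) : a - a' <= c -> b - b' <= c ->
  Num.min a b - Num.min a' b' <= c.
Proof.
move=> h k; rewrite lerBlDr addrC -lerBlDr le_min.
by rewrite !lerBlDr !ge_min; apply/andP; split; apply/orP; [left|right]; lra.
Qed.

Lemma path_dist_positivity (genS : generates (val : S -> G)) p q :
  path_dist p q = 0 -> p = q.
Proof.
case: p => [v|x s t] d0.
  have lip : vdist v q - vdist v (Vertex R S v) <= 0.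
    rewrite -d0; apply: path_dist_lip => // y a t u t01 u01.
    have := ler_norm (u - t); have := ler_norm (t - u); rewrite distrC => h k.
    have h0 := normr_ge0 (u - t).
    by rewrite !vdistE//; apply: min_lip; case: ifP => _; lra.
  rewrite /= eqxx subr0 in lip.
  case: q {d0} lip => [y|y a u] /=.
    by have [->|_] := eqVneq y v; last rewrite ler10.
  case/andP: (valP u) => u0 u1.
  move=> h; exfalso; move: h; rewrite leNgt => /negP; apply.
  by rewrite lt_min; apply/andP; split; case: ifP; rewrite ?subr_gt0.
have t01 := valP t; have /andP[t0 t1] := t01.
have lip : idist x s (val t) q - idist x s (val t) (Interior x s t) <= 0.
  rewrite -[leRHS]d0; apply: path_dist_lip => // y a t' u t'01 u01.
  rewrite !idistE//; have h0 := normr_ge0 (u - t').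
  case: ifP => _; last by rewrite subrr.
  apply: min_lip; last by rewrite subrr.
  by rewrite (le_trans (lerB_dist _ _))// opprB addrA subrK.
have r0 : 0 < Num.min (val t) (1 - val t) by rewrite lt_min t0 subr_gt0.
rewrite /= !eqxx subrr normr0 (min_idPl (ltW r0)) subr0 in lip.
case: q {d0} lip => [y|y a u] /=; first by rewrite leNgt r0.
case: ifP => [/andP[/eqP -> /eqP ->]|_]; last by rewrite leNgt r0.
rewrite ge_min [X in _ || X]leNgt r0 orbF normr_le0 subr_eq0 => /eqP ut.
by congr Interior; apply/val_inj.
Qed.

End cayley.

(* The points of the Cayley graph of G with respect to S; the proof that S
   generates G makes the path metric finite. *)
Definition cayley_graph (R : realType) (G : groupType) (S : {fset G})
  (genS : generates (val : S -> G)) : Type := cayley_point R S.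

Section cayley_graph_metric.
Context (R : realType) (G : groupType) (S : {fset G}).
Context (genS : generates (val : S -> G)).

HB.instance Definition _ := gen_eqMixin (cayley_graph R genS).
HB.instance Definition _ := gen_choiceMixin (cayley_graph R genS).
HB.instance Definition _ :=
  isMetric.Build R (cayley_graph R genS)
    (@path_distxx R G S) (path_dist_positivity genS)
    (@path_dist_sym R G S) (path_dist_triangle genS).

End cayley_graph_metric.

(* Main.v *)
(* Suppose asdim G <= 1. Take the Cayley graph with respect to a ball large
   enough to contain the relators, so that its clique complex has trivial
   first cohomology mod 2. The cover gives a 2-colouring of the vertices whose
   monochromatic components A are uniformly bounded. By one-endedness the
   complement of A has a single infinite component U(A), and by homogeneity the
   size of its complement is bounded independently of A. By simple connectivity
   the vertices of U(A) adjacent to A form a connected set; none has the colour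
   of A, so they lie in one monochromatic component A', and U(A') is strictly
   smaller than U(A). Iterating contradicts the uniform bound. *)
Require Import Defs.
From mathcomp Require Import all_boot all_order all_algebra finmap.
From mathcomp Require Import all_classical all_reals.
From mathcomp Require Import ereal topology.
From mathcomp Require Import normedtype.
From mathcomp Require Import ring lra.

Set Implicit Arguments.
Unset Strict Implicit.
Unset Printing Implicit Defensive.

Import Order.TTheory GRing.Theory Num.Theory.
Import numFieldNormedType.Exports.

Local Open Scope classical_set_scope.

(** * Linked subsets of a graph *)

Inductive linked (T : Type) (e : T -> T -> Prop) (P : set T) : T -> T -> Prop :=
| linked_refl x : P x -> linked e P x x
| linked_step x y z : P x -> e x y -> linked e P y z -> linked e P x z.

Lemma linked_map (T U : Type) (e : T -> T -> Prop) (e' : U -> U -> Prop)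
    (P : set T) (Q : set U) (f : T -> U) x y :
  (forall u v, e u v -> e' (f u) (f v)) -> (forall u, P u -> Q (f u)) ->
  linked e P x y -> linked e' Q (f x) (f y).
Proof.
move=> ee' PQ; elim=> [u /PQ|u v w /PQ Qu /ee' euv _]; first exact: linked_refl.
exact: linked_step.
Qed.

Section linked.
Context {T : Type}.
Implicit Types (e : T -> T -> Prop) (P Q : set T).

Lemma linked_l e P x y : linked e P x y -> P x.
Proof. by case. Qed.

Lemma linked_r e P x y : linked e P x y -> P y.
Proof. by elim. Qed.

Lemma linked1 e P x y : P x -> P y -> e x y -> linked e P x y.
Proof. by move=> Px Py exy; apply: linked_step exy _ => //; left. Qed.

Lemma linked_trans e P x y z :
  linked e P x y -> linked e P y z -> linked e P x z.
Proof.
elim=> // x' y' z' Px exy _ IH /IH yz.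
exact: linked_step exy yz.
Qed.

Lemma linked_sym e P x y :
  (forall u v, e u v -> e v u) -> linked e P x y -> linked e P y x.
Proof.
move=> e_sym; elim=> [u Pu|u v w Pu euv vw IH]; first exact: linked_refl.
apply: linked_trans IH _; apply: linked1 (e_sym _ _ euv) => //.
exact: linked_l vw.
Qed.

Lemma linked_sub e e' P Q x y :
  (forall u v, e u v -> e' u v) -> P `<=` Q ->
  linked e P x y -> linked e' Q x y.
Proof. by move=> ee' PQ; exact: (linked_map (f := id)). Qed.

Lemma linked_cross e P Q x y : linked e P x y -> Q x -> ~ Q y ->
  exists u v, [/\ linked e P x u, P v, e u v, Q u & ~ Q v].
Proof.
elim=> // u v w Pu euv vw IH Qu nQw.
have [Qv|nQv] := pselect (Q v); last first.
  by exists u, v; split=> //; [exact: linked_refl|exact: linked_l vw].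
have [a [b [va Pb eab Qa nQb]]] := IH Qv nQw.
by exists a, b; split=> //; apply: linked_step euv va.
Qed.

Lemma linked_class e P x y : linked e P x y -> linked e (linked e P x) x y.
Proof.
elim=> [u Pu|u v w Pu euv vw IH]; first by do 2 apply: linked_refl.
apply: (linked_step _ euv); first exact: linked_refl.
by apply: linked_sub IH => // t; apply: linked_step euv.
Qed.

(* Simple connectivity: H^1(-, Z/2) of the clique complex of e vanishes. *)
Definition cocycles_trivial e :=
  forall phi : T -> T -> bool,
    (forall x y z, e x y -> e y z -> e x z -> phi x z = phi x y (+) phi y z) ->
    exists Phi : T -> bool, forall x y, e x y -> phi x y = Phi x (+) Phi y.

Lemma linked_const e P (Phi : T -> bool) x y :
  (forall u v, P u -> P v -> e u v -> Phi u (+) Phi v = false) ->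
  linked e P x y -> Phi x = Phi y.
Proof.
move=> h; elim=> // u v w Pu euv vw <-.
by have := h u v Pu (linked_l vw) euv; case: (Phi u); case: (Phi v).
Qed.

Definition inner_boundary e (U : set T) :=
  [set u | U u /\ exists2 v, e u v & ~ U v].

(* A part of the boundary not linked to the rest would be crossed an even
   number of times by every triangle, hence by every closed path; but a closed
   path through A and U can be made to cross it exactly once. *)
Lemma inner_boundary_linked e (A U : set T) u v :
  (forall x y, e x y -> e y x) -> cocycles_trivial e ->
  (forall x y, A x -> A y -> linked e A x y) ->
  (forall x y, U x -> U y -> linked e U x y) ->
  A `<=` ~` U ->
  (forall x y, U x -> e x y -> ~ U y -> A y) ->
  inner_boundary e U u -> inner_boundary e U v ->
  linked e (inner_boundary e U) u v.
Proof.
move=> e_sym triv Alk Ulk AU UA uB vB.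
set B := inner_boundary e U; set P := linked e B u.
have PU x : P x -> U x by move=> /linked_r[].
(* In a triangle with only [z] outside [U], both other vertices lie on the boundary, hence in the
   same class; this makes [phi] below a cocycle. *)
have Padj x y z : U x -> U y -> ~ U z -> e x y -> e x z -> e y z -> P x -> P y.
  move=> Ux Uy Uz xy xz yz Px; apply: linked_trans Px _.
  by apply: linked1 xy; split=> //; exists z.
(* [phi] marks the edges between [P] and the complement of [U], in both directions; every triangle
   has an even number of them. *)
pose phi x y := `[< P x /\ ~ U y >] (+) `[< P y /\ ~ U x >].
have phiUU x y : U x -> U y -> phi x y = false.
  by move=> Ux Uy; rewrite /phi; do 2 (rewrite asboolF; last by case).
have phiCC x y : ~ U x -> ~ U y -> phi x y = false.
  by move=> Ux Uy; rewrite /phi; do 2 (rewrite asboolF; last by case=> /PU).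
have phiUC x y : U x -> ~ U y -> phi x y = `[< P x >].
  move=> Ux Uy; rewrite /phi [X in _ (+) X]asboolF ?addbF; last by case.
  by apply: asbool_equiv_eq; split=> // -[].
have phiC x y : phi x y = phi y x by rewrite /phi addbC.
have [|Phi PhiE] := triv phi.
  move=> x y z xy yz xz.
  have [yx zy zx] := And3 (e_sym _ _ xy) (e_sym _ _ yz) (e_sym _ _ xz).
  have [[Ux|Ux] [Uy|Uy] [Uz|Uz]] := And3 (EM (U x)) (EM (U y)) (EM (U z)).
  - by rewrite !phiUU.
  - rewrite (phiUU x y)// !phiUC//.
    by apply: asbool_equiv_eq; split; apply: Padj Uz _ _ _ => //.
  - rewrite (phiUU x z)// phiUC// phiC phiUC//.
    by rewrite (@asbool_equiv_eq (P x) (P z)) ?addbb//;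
      split; apply: Padj Uy _ _ _ => //.
  - by rewrite (phiCC y z)// !phiUC// addbF.
  - rewrite (phiUU y z)// !(phiC x) !phiUC// addbF.
    by apply: asbool_equiv_eq; split; apply: Padj Ux _ _ _ => //.
  - by rewrite (phiCC x z)// (phiC x) !phiUC// addbb.
  - by rewrite (phiCC x y)// !(phiC _ z) !phiUC.
  - by rewrite !phiCC.
(* Compare the exits from [u] to [a] and from [v] to [b]: [phi] vanishes along paths in [U] and in
   [A], so [Phi] agrees on [u] and [v], and on [a] and [b]. *)
have [Uu [a ua Ua]] := uB; have [Uv [b vb Ub]] := vB.
have Phiuv : Phi u = Phi v.
  by apply: linked_const (Ulk u v Uu Uv) => x y Ux Uy /PhiE <-; exact: phiUU.
have Phiab : Phi a = Phi b.
  have Aab : linked e A a b.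
    by apply: Alk; [exact: UA Uu ua Ua|exact: UA Uv vb Ub].
  by apply: linked_const Aab => x y /AU Ux /AU Uy /PhiE <-; exact: phiCC.
have : phi u a = phi v b by rewrite !PhiE// Phiuv Phiab.
rewrite !phiUC// asboolT; last exact: linked_refl.
by move=> /esym/asboolP.
Qed.

End linked.

(** * Bounded 2-colourings *)

Section coloring.
Context {T : choiceType} (e : T -> T -> Prop) (col : T -> bool) (N : nat).
Hypotheses (e_sym : forall x y, e x y -> e y x)
  (econn : forall x y, linked e setT x y) (etriv : cocycles_trivial e)
  (Tinf : infinite_set [set: T]).

Let mono x := [set y | linked e [set z | col z = col x] x y].

(** The bound [N] is uniform in [x], which drives the final contradiction. Taking [y = z] shows that
    [F] contains [mono x]. *)
Hypothesis mono_coconn : forall x, exists F : {fset T}, (#|` F| <= N)%N /\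
  forall y z, y \notin F -> z \notin F -> linked e (~` mono x) y z.

(** This is [U(A)] for [A = mono x], written without choosing a component; [outer_linked] shows that
    it is connected. *)
Let outer x := [set y | infinite_set [set z | linked e (~` mono x) y z]].

Let infinite_meets (A : set T) (F : {fset T}) : infinite_set A ->
  exists2 y, A y & y \notin F.
Proof.
move=> Ainf; have [y] := infinite_setN0 (infinite_setD Ainf (finite_fset F)).
by move=> [Ay /negP yF]; exists y.
Qed.

(** A vertex outside [F] is linked to the whole complement of [F], which is infinite, so it belongs
    to [outer x]. *)
Let outerP x : exists F : {fset T}, [/\ (#|` F| <= N)%N,
  forall y, ~ outer x y -> y \in F &
  forall y z, y \notin F -> z \notin F -> linked e (~` mono x) y z].
Proof.
have [F [FN Flk]] := mono_coconn x; exists F; split=> // y yU.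
apply/negPn/negP => yF; apply: yU.
apply: sub_infinite_set (infinite_setD Tinf (finite_fset F)) => z [_ /negP zF].
exact: Flk.
Qed.

Let outer_sub x y : outer x y -> ~ mono x y.
Proof. by move=> /infinite_setN0[z] /= yz; exact: linked_l yz. Qed.

Let outer_step x y z : outer x y -> linked e (~` mono x) y z -> outer x z.
Proof.
move=> yinf yz; apply: sub_infinite_set yinf => t /= yt.
exact: linked_trans (linked_sym e_sym yz) yt.
Qed.

Let outer_linked x y z : outer x y -> outer x z -> linked e (outer x) y z.
Proof.
move=> yU zU; have [F [_ _ Flk]] := outerP x.
have [y' yy' y'F] := infinite_meets F yU.
have [z' zz' z'F] := infinite_meets F zU.
have yz : linked e (~` mono x) y z.
  apply: linked_trans yy' _.
  exact: linked_trans (Flk _ _ y'F z'F) (linked_sym e_sym zz').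
by apply: linked_sub (linked_class yz) => // t; exact: outer_step.
Qed.

Let mono_refl x : mono x x. Proof. exact: linked_refl. Qed.

Let outer_shrink x : exists x', outer x' `<` outer x.
Proof.
have [F [FN UF Flk]] := outerP x.
have [u0 _ u0F] := infinite_meets F Tinf.
have u0U : outer x u0 by apply: contrapT => /UF; rewrite (negbTE u0F).
have [u [v [_ _ uv uU vU]]] : exists u v, [/\ linked e setT u0 u, setT v, e u v,
    outer x u & ~ outer x v].
  by apply: linked_cross (econn u0 x) _ _ => // /outer_sub; exact.
have exit y z : outer x y -> e y z -> ~ outer x z -> mono x z.
  move=> yU yz zU; apply: contrapT => zM; apply/zU/(outer_step yU).
  by apply: linked1 yz => //; exact: outer_sub.
(* A neighbour of [mono x] with the colour of [x] would itself belong to [mono x]. *)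
have bdcol z : inner_boundary e (outer x) z -> col z = ~~ col x.
  move=> [zU [t zt tU]]; have tM := exit z t zU zt tU.
  have : ~ (col z = col x); last by case: (col z); case: (col x).
  move=> zx; apply: (outer_sub zU); apply: (linked_trans tM).
  by apply: linked1 (e_sym zt) => //; exact: linked_r tM.
have uB : inner_boundary e (outer x) u by split=> //; exists v.
(* The boundary is linked, by simple connectivity, and has one colour, so a single monochromatic
   component contains it. *)
have bdmono : inner_boundary e (outer x) `<=` mono u.
  move=> w wB; have uw : linked e (inner_boundary e (outer x)) u w.
    apply: (@inner_boundary_linked _ e (mono x)) => //.
    - move=> y z xy xz.
      apply: linked_trans (linked_class xz).
      exact: linked_sym e_sym (linked_class xy).
    - exact: outer_linked.
    - by move=> y yM /outer_sub.
  by apply: linked_sub uw => // z zB /=; rewrite (bdcol z zB) (bdcol u uB).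
(* Strictness: [u] lies in [outer x] but also in [mono u], which [outer u] avoids. *)
exists u; split; last first.
  by move=> /(_ _ uU)/outer_sub; apply.
(* A path avoiding [mono u] from [y] to a vertex outside [F] would enter [outer x] through its
   boundary, which lies in [mono u]. *)
move=> y yU; apply: contrapT => yxU.
have [z yz zF] := infinite_meets F yU.
have zU : ~ ~ outer x z by move=> /UF; rewrite (negbTE zF).
have [p [q [_ qM pq pU qU]]] := linked_cross (Q := ~` outer x) yz yxU zU.
apply/qM/bdmono; split; first exact: contrapT.
by exists p => //; exact: e_sym.
Qed.

(** Each use of [outer_shrink] strictly enlarges the finite complement of [outer], whose size never
    exceeds [N]. *)
Lemma no_bounded_2coloring : False.
Proof.
have Ufin x : finite_set (~` outer x).
  have [F [_ UF _]] := outerP x.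
  by apply: sub_finite_set (finite_fset F) => y /UF.
have [x0 _ _] := infinite_meets fset0 Tinf.
have grow k : exists x, (k <= #|` fset_set (~` outer x)|)%N.
  elim: k => [|k [x kx]]; first by exists x0.
  have [x' [sub nsub]] := outer_shrink x; exists x'.
  apply: leq_ltn_trans kx _; apply: fproper_ltn_card; rewrite fproperEneq.
  apply/andP; split; last first.
    by rewrite -(fset_set_sub (Ufin x) (Ufin x')); exact: subsetC.
  apply/eqP => /(fset_set_inj (Ufin x) (Ufin x')) E; apply: nsub.
  by rewrite -[outer x]setCK E setCK.
have [x] := grow N.+1; rewrite ltnNge => /negP; apply.
have [F [FN UF _]] := outerP x.
apply: leq_trans FN; apply/fsubset_leq_card/fsubsetP => y.
by rewrite in_fset_set// inE => /UF.
Qed.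

End coloring.

(** * Words and word balls *)

Section words.
Context {G : groupType} {I : Type} (f : I -> G).
Implicit Types (u v w : word I) (x y g : G).
Local Open Scope group_scope.

Definition letter_eval (a : I * bool) : G := if a.2 then (f a.1)^-1 else f a.1.

Lemma word_eval_nil : word_eval f [::] = 1.
Proof. by rewrite /word_eval big_nil. Qed.

Lemma word_eval1 a : word_eval f [:: a] = letter_eval a.
Proof. by rewrite /word_eval big_seq1. Qed.

Lemma word_eval_cat u v : word_eval f (u ++ v) = word_eval f u * word_eval f v.
Proof. by rewrite /word_eval big_cat. Qed.

Lemma word_eval_cons a w : word_eval f (a :: w) = letter_eval a * word_eval f w.
Proof. by rewrite /word_eval big_cons. Qed.

Lemma word_eval_rcons w a :
  word_eval f (rcons w a) = word_eval f w * letter_eval a.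
Proof. by rewrite -cats1 word_eval_cat word_eval1. Qed.

Definition word_inv w : word I := rev [seq (a.1, ~~ a.2) | a <- w].

Lemma size_word_inv w : size (word_inv w) = size w.
Proof. by rewrite size_rev size_map. Qed.

Lemma word_eval_inv w : word_eval f (word_inv w) = (word_eval f w)^-1.
Proof.
elim: w => [|[i b] w IH]; first by rewrite word_eval_nil invg1.
rewrite /word_inv map_cons rev_cons word_eval_rcons IH word_eval_cons invgM.
by congr (_ * _); case: b => //=; rewrite /letter_eval /= invgK.
Qed.

Definition word_ball n : set G :=
  [set g | exists2 w, (size w <= n)%N & word_eval f w = g].

Lemma word_ball_eval w n : (size w <= n)%N -> word_ball n (word_eval f w).
Proof. by exists w. Qed.

Lemma word_ball1 n : word_ball n 1.
Proof. by exists [::]; rewrite ?word_eval_nil. Qed.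

Lemma word_ball_letter n a : word_ball n.+1 (letter_eval a).
Proof. by exists [:: a]; rewrite ?word_eval1. Qed.

Lemma word_ballV n g : word_ball n g -> word_ball n g^-1.
Proof.
by move=> [w wn <-]; exists (word_inv w); rewrite ?size_word_inv ?word_eval_inv.
Qed.

Lemma word_ballM m n g h :
  word_ball m g -> word_ball n h -> word_ball (m + n) (g * h).
Proof.
move=> [u um <-] [v vn <-]; exists (u ++ v); last exact: word_eval_cat.
by rewrite size_cat leq_add.
Qed.

Lemma word_ballS m n : (m <= n)%N -> word_ball m `<=` word_ball n.
Proof. by move=> mn g [w wm <-]; exists w => //; exact: leq_trans mn. Qed.

Lemma word_ball_bounded (A : set G) :
  generates f -> finite_set A -> exists n, A `<=` word_ball n.
Proof.
move=> gen /finite_seqP[s ->]; elim: s => [|g s [n sn]]; first by exists 0%N.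
have [w wg] := gen g; exists (maxn n (size w)) => h /=.
rewrite inE => /orP[/eqP->|/sn]; last by apply: word_ballS; rewrite leq_maxl.
by rewrite -wg; apply: word_ball_eval; rewrite leq_maxr.
Qed.

(** Adjacency is by right multiplication, so that left translations are automorphisms. *)
Definition cayley_adj (N : set G) x y := N (x^-1 * y).

Lemma cayley_adj_sym n x y :
  cayley_adj (word_ball n) x y -> cayley_adj (word_ball n) y x.
Proof. by move=> /word_ballV; rewrite /cayley_adj invgM invgK. Qed.

Lemma cayley_adjM (N : set G) g x y :
  cayley_adj N (g * x) (g * y) <-> cayley_adj N x y.
Proof. by rewrite /cayley_adj invgM -mulgA mulKg. Qed.

Lemma linked_mul (N P : set G) g x y :
  linked (cayley_adj N) P x y ->
  linked (cayley_adj N) [set h | P (g^-1 * h)] (g * x) (g * y).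
Proof.
apply: linked_map => [u v uv|u Pu /=]; last by rewrite mulKg.
exact/cayley_adjM.
Qed.

Lemma cayley_linked n x y : generates f -> (0 < n)%N ->
  linked (cayley_adj (word_ball n)) setT x y.
Proof.
case: n => // n gen _; have [w wE] := gen (x^-1 * y).
have -> : y = x * word_eval f w by rewrite wE mulVKg.
elim/last_ind: w {wE y} => [|w a IH].
  by rewrite word_eval_nil mulg1; exact: linked_refl.
apply: linked_trans IH _; apply: linked1 => //.
by rewrite word_eval_rcons mulgA /cayley_adj mulKg; exact: word_ball_letter.
Qed.

End words.

Lemma finite_word_ball (G : groupType) (I : finType) (f : I -> G) n :
  finite_set (word_ball f n).
Proof.
elim: n => [|n IH].
  by apply: sub_finite_set (finite_set1 1%g) => g [[]// _ <-];
    exact: word_eval_nil.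
have Bfin := finite_image2 (fun a g => letter_eval f a * g)%g
  (@finite_finset (I * bool)%type setT) IH.
have := conj (finite_set1 (1%g : G)) Bfin; rewrite -finite_setU.
apply: sub_finite_set => g [[|a w] wn <-].
  by left; exact: word_eval_nil.
right; exists a => //; exists (word_eval f w); first exact: word_ball_eval.
by rewrite word_eval_cons.
Qed.

(** * Cocycles on the Cayley graph of a presentation *)

Section word_sum.
Context {G : groupType} {I : Type} (f : I -> G) (phi : G -> G -> bool).
Local Open Scope group_scope.

(** The integral mod 2 of [phi] along the path that starts at [x] and reads [w]. *)
Fixpoint word_sum (x : G) (w : word I) : bool :=
  if w is a :: w' then
    phi x (x * letter_eval f a) (+) word_sum (x * letter_eval f a) w'
  else false.

Lemma word_sum_cat x u v :
  word_sum x (u ++ v) = word_sum x u (+) word_sum (x * word_eval f u) v.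
Proof.
elim: u x => [|a u IH] x /=; first by rewrite word_eval_nil mulg1.
by rewrite IH word_eval_cons mulgA addbA.
Qed.

Context (n : nat).
Hypothesis phi_cocycle : forall x y z,
  cayley_adj (word_ball f n) x y -> cayley_adj (word_ball f n) y z ->
  cayley_adj (word_ball f n) x z -> phi x z = phi x y (+) phi y z.

Lemma cocycle_refl x : phi x x = false.
Proof.
have xx : cayley_adj (word_ball f n) x x.
  by rewrite /cayley_adj mulVg; exact: word_ball1.
by have := phi_cocycle xx xx xx; case: (phi x x).
Qed.

(* The path and its chord bound a fan of triangles with apex x. *)
Lemma word_sum_short x w : (size w <= n)%N ->
  word_sum x w = phi x (x * word_eval f w).
Proof.
elim/last_ind: w => [|w a IH] wn.
  by rewrite word_eval_nil mulg1 cocycle_refl.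
rewrite size_rcons in wn.
rewrite -cats1 word_sum_cat IH; last exact: ltnW.
rewrite /= addbF cats1 word_eval_rcons mulgA; symmetry; apply: phi_cocycle.
- by rewrite /cayley_adj mulKg; apply: word_ball_eval; exact: ltnW.
- by rewrite /cayley_adj mulKg; case: (n) wn => // m _; exact: word_ball_letter.
- by rewrite -mulgA -word_eval_rcons /cayley_adj mulKg;
    apply: word_ball_eval; rewrite size_rcons.
Qed.

End word_sum.

(** The sum along a word depends only on its start and its value: cancelling pairs and relators have
    length at most [n], so the sum around them is [phi x x], which is zero. Summing from [1] then
    defines a primitive. *)
Lemma presentation_cocycles_trivial (G : groupType) (I : eqType) (f : I -> G)
    (rels : seq (word I)) n :
  generates f ->
  (forall u v, word_eval f u = word_eval f v <-> presentation_eq rels u v) ->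
  (1 < n)%N -> {in rels, forall r, size r <= n}%N ->
  cocycles_trivial (cayley_adj (word_ball f n)).
Proof.
move=> gen pres n1 reln phi phiP.
have sumE u v : presentation_eq rels u v ->
    forall x, word_sum f phi x u = word_sum f phi x v.
  elim=> [//|u' v' _ IH x|u' v' w' _ IH _ IH' x|u1 u2 v1 v2 uu IHu vv IHv x
         |a b x|r rr x].
  - by rewrite IH.
  - by rewrite IH IH'.
  (* The second factors start at the same vertex, since [u1] and [u2] have the same value. *)
  - by rewrite !word_sum_cat IHu IHv; have /pres -> := uu.
  - rewrite (word_sum_short phiP)//.
    have /pres -> := PEq_cancel rels a b.
    by rewrite word_eval_nil mulg1 (cocycle_refl phiP).
  - rewrite (word_sum_short phiP) ?reln//.
    have /pres -> := PEq_rel rr.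
    by rewrite word_eval_nil mulg1 (cocycle_refl phiP).
have [W WE] := choice gen.
exists (fun x => word_sum f phi 1%g (W x)) => x y [w wn wE].
have -> : word_sum f phi 1%g (W y) = word_sum f phi 1%g (W x ++ w).
  apply: sumE; apply/pres.
  by rewrite word_eval_cat !WE wE mulVKg.
rewrite word_sum_cat mul1g WE (word_sum_short phiP x wn) wE mulVKg.
by rewrite addbA addbb.
Qed.

Local Open Scope ring_scope.

(** * Bounded sets *)

Section bounded.
Context {R : realType} {X : metricType R}.

Lemma ereal_sup_lty (A : set (\bar R)) :
  (ereal_sup A < +oo)%E <-> exists r : R, forall a, A a -> (a <= r%:E)%E.
Proof.
split=> [supA|[r Ar]]; last first.
  by apply: le_lt_trans (ltry r); exact: ge_ereal_sup.
(* If the supremum is [-oo], [fine] returns [0], still an upper bound. *)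
exists (fine (ereal_sup A)) => a Aa.
have aA : (a <= ereal_sup A)%E by exact: ereal_sup_ubound.
move: supA aA; case: (ereal_sup A) => //= _.
by rewrite leeNy_eq => /eqP ->; rewrite leNye.
Qed.

Lemma diam_le (A : set X) (r : R) :
  (diam A <= r%:E)%E <-> forall x y, A x -> A y -> mdist x y <= r.
Proof.
split=> [Ar x y Ax Ay|Ar].
  rewrite -lee_fin; apply: le_trans Ar; apply: ereal_sup_ubound.
  by exists (x, y).
by apply: ge_ereal_sup => _ [[x y] [Ax Ay] <-]; rewrite lee_fin; exact: Ar.
Qed.

Lemma metric_boundedP (A : set X) :
  metric_bounded A <-> exists r, forall x y, A x -> A y -> mdist x y <= r.
Proof.
split=> [/ereal_sup_lty[r Ar]|[r /diam_le Ar]].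
  exists r; apply/diam_le; exact: ge_ereal_sup.
exact: le_lt_trans Ar (ltry r).
Qed.

(** A step shorter than [d] cannot pass from one piece [B i] to another, so the path stays in one
    piece, and the diameters are uniformly bounded. *)
Lemma d_disconnected_linked (d : R) (Y : set X) : d_disconnected d Y ->
  exists r, forall x y,
    linked (fun p q => mdist p q < d) Y x y -> mdist x y <= r.
Proof.
move=> [I [B [YB /ereal_sup_lty[r Br] Bd]]]; exists r => x y xy.
have [i _ Bix] : (\bigcup_i B i) x by rewrite -YB; exact: linked_l xy.
apply: ((diam_le (B i) r).1 _ _ _ Bix); first by apply: Br; exists i.
elim: xy Bix => // p q z Yp pq qz IH Bip; apply: IH.
have [j _ Bjq] : (\bigcup_i B i) q by rewrite -YB; exact: linked_l qz.
have [->//|ij] := EM (i = j).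
have : (d%:E <= (mdist p q)%:E)%E.
  by apply: le_trans (Bd i j ij) _; apply: ereal_inf_lbound; exists (p, q).
by rewrite lee_fin leNgt pq.
Qed.

(** [f] is continuous, so it maps [C] onto an interval; a sign change would force a zero. *)
Lemma lipschitz_connected_gt0 (f : X -> R) (C : set X) x y :
  (forall p q, `|f p - f q| <= mdist p q) -> connected C ->
  (forall p, C p -> f p != 0) -> C x -> C y -> 0 < f x -> 0 < f y.
Proof.
move=> flip Cc Cf Cx Cy fx; rewrite ltNge; apply/negP => fy.
have cf : continuous f.
  move=> p; apply/cvgrPdist_lt => eps eps0.
  apply/nbhs_ballP; exists eps => //= q; rewrite ballEmdist.
  exact: le_lt_trans (flip p q).
have /connected_intervalP fC : connected (f @` C).
  by apply: connected_continuous_connected => //; exact: continuous_subspaceT.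
have [|p Cp fp] := fC _ _ (imageP f Cy) (imageP f Cx) 0.
  by rewrite fy ltW.
by have := Cf p Cp; rewrite fp eqxx.
Qed.

End bounded.

(** * Geometry of the Cayley graph *)

Section cayley_graph_geometry.
Context {R : realType} {G : groupType} {S : {fset G}}.
Context (genS : generates (val : S -> G)).
Local Notation X := (cayley_graph R genS).
Local Notation ball1 := (word_ball (val : S -> G)).

Let V (g : G) : X := Vertex R S g.

Lemma cayley_mdistE (p q : X) : mdist p q = path_dist p q.
Proof. by []. Qed.

(** The affine extension of [h] along edges; it turns bounds on jumps over [G] into Lipschitz bounds
    on the metric graph. *)
Definition interpolate (h : G -> R) (p : X) : R :=
  match p with
  | Vertex x => h x
  | Interior x s t => (1 - val t) * h x + val t * h (x * val s)%g
  end.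

Lemma interpolateE h x (s : S) (t : R) : 0 <= t <= 1 ->
  interpolate h (edge_point x s t) = (1 - t) * h x + t * h (x * val s)%g.
Proof.
move=> t01; have [[-> ->]|[-> ->]|[u -> ->]//] := edge_pointP x s t01 => /=.
  by rewrite subr0 mul1r mul0r addr0.
by rewrite subrr mul1r mul0r add0r.
Qed.

Lemma interpolate_lip h : (forall x (s : S), `|h (x * val s)%g - h x| <= 1) ->
  forall p q, `|interpolate h p - interpolate h q| <= mdist p q.
Proof.
move=> hlip.
have lip p q : interpolate h q - interpolate h p <= mdist p q.
  apply: (path_dist_lip genS (f := interpolate h)) => x s t u t01 u01.
  rewrite !interpolateE//.
  have -> : (1 - u) * h x + u * h (x * val s)%g -
      ((1 - t) * h x + t * h (x * val s)%g) =
      (u - t) * (h (x * val s)%g - h x) by ring.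
  apply: le_trans (ler_norm _) _; rewrite normrM.
  by rewrite ler_piMr.
by move=> p q; rewrite ler_norml lerNl opprB lip/= metric_sym lip.
Qed.

Let len_subproof g : exists n, `[< ball1 n g >].
Proof.
by have [w <-] := genS g; exists (size w); apply/asboolP/word_ball_eval.
Qed.

Let len g := ex_minn (len_subproof g).

Let lenP g n : (len g <= n)%N <-> ball1 n g.
Proof.
rewrite /len; case: ex_minnP => m /asboolP mg mmin; split=> [mn|ng].
  exact: word_ballS mn _ mg.
exact/mmin/asboolP.
Qed.

Let len_letter g a : (len (g * letter_eval (val : S -> G) a)%g <= (len g).+1)%N.
Proof.
apply/lenP; rewrite -addn1; apply: word_ballM; last exact: word_ball_letter.
exact/lenP.
Qed.

(** Word length measured from [g] changes by at most one along an edge, so its interpolation is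
    1-Lipschitz. *)
Lemma vertex_dist_ge g h n : mdist (V g) (V h) <= n%:R -> ball1 n (g^-1 * h)%g.
Proof.
move=> ghn; apply/lenP; rewrite -(ler_nat R); apply: le_trans ghn.
pose f y : R := (len (g^-1 * y)%g)%:R.
have /interpolate_lip : forall x (s : S), `|f (x * val s)%g - f x| <= 1.
  move=> x s; rewrite /f mulgA; set y := (g^-1 * x)%g.
  have := len_letter y (s, false); rewrite /letter_eval/= -(ler_nat R) => h1.
  have := len_letter (y * val s)%g (s, true).
  rewrite /letter_eval/= mulgK -(ler_nat R) => h2.
  by move: h1 h2; rewrite -!natr1 ler_norml => h1 h2; apply/andP; split; lra.
move=> /(_ (V h) (V g)); rewrite metric_sym; apply: le_trans.
suff -> : interpolate f (V g) = 0 by rewrite subr0 ler_norm.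
rewrite /= /f mulVg; have /lenP := word_ball1 (val : S -> G) 0.
by rewrite leqn0 => /eqP ->.
Qed.

Lemma vertex_dist_le g h n : ball1 n (g^-1 * h)%g -> mdist (V g) (V h) <= n%:R.
Proof.
move=> [w wn wE].
suff : edge_path (V g) (V h) (size w)%:R.
  by move=> /path_dist_le/le_trans; apply; rewrite ler_nat.
have -> : h = (g * word_eval (val : S -> G) w)%g by rewrite wE mulVKg.
elim: w g {wn wE} => [|a w IH] g /=.
  by rewrite word_eval_nil mulg1; constructor.
rewrite word_eval_cons mulgA -natr1 addrC.
exact: edge_path_cat (edge_path_letter R g a) (IH _).
Qed.

(** All real parameters are allowed, so that continuity holds on the whole line: beyond [[0, 1]] the
    value of [edge_point] stays at an end vertex, hence the clamping. *)
Lemma edge_point_lip x (s : S) (t u : R) :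
  mdist (edge_point x s t : X) (edge_point x s u) <= `|t - u|.
Proof.
pose clamp (v : R) := if v <= 0 then 0 else if v <= 1 then v else 1.
have clampE v : edge_point x s v = edge_point x s (clamp v).
  rewrite /clamp; have [v0|v0] := leP v 0.
    by rewrite edge_point0 /edge_point insubN ?v0// negb_and -leNgt v0.
  have [//|v1] := leP v 1.
  rewrite edge_point1 /edge_point insubN ?leNgt ?v0//.
  by rewrite negb_and -!leNgt (ltW v1) orbT.
have clamp01 v : 0 <= clamp v <= 1.
  rewrite /clamp; case: (leP v 0) => v0; first by rewrite lexx ler01.
  by case: (leP v 1) => v1; rewrite ?lexx ?ler01// (ltW v0).
rewrite (clampE t) (clampE u).
rewrite cayley_mdistE.
apply: (le_trans (path_dist_le (edge_path1 x s (clamp01 t) (clamp01 u)))).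
rewrite ler_norml /clamp; have := ler_norm (t - u); have := ler_norm (u - t).
rewrite (distrC u t); case: (leP t 0) => ?; case: (leP u 0) => ?;
  case: (leP t 1) => ?; case: (leP u 1) => ? ? ?; apply/andP; split; lra.
Qed.

Lemma edge_connected x (s : S) :
  connected ((fun t : R => edge_point x s t : X) @` `[0, 1]).
Proof.
apply: connected_continuous_connected; first exact: segment_connected.
apply: continuous_subspaceT => t.
apply/cvg_ballP => eps eps0.
apply/nbhs_ballP; exists eps => //= u tu; rewrite ballEmdist.
exact: le_lt_trans (edge_point_lip x s t u) tu.
Qed.

Let base (p : X) := match p with Vertex x | Interior x _ _ => x end.

Let base_dist p : mdist (V (base p)) p <= 1.
Proof.
case: p => [x|x s t] /=; first by rewrite mdistxx.
rewrite -edge_point_in /V -(edge_point0 R x s).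
apply: le_trans (edge_point_lip x s _ _) _.
by case/andP: (valP t) => t0 t1; rewrite sub0r normrN gtr0_norm// ltW.
Qed.

Lemma near_finite_bounded (A : set G) (P : set X) : finite_set A ->
  (forall p, P p -> exists2 g, A g & mdist (V g) p <= 1) -> metric_bounded P.
Proof.
move=> /(word_ball_bounded genS)[n An] PA.
have PV p : P p -> mdist (V 1%g) p <= n%:R + 1.
  move=> /PA[g /An gn gp]; apply: le_trans (metric_triangle _ (V g) _) _.
  by rewrite lerD// vertex_dist_le// invg1 mul1g.
apply/metric_boundedP; exists ((n%:R + 1) + (n%:R + 1)) => p q /PV Pp /PV Pq.
apply: le_trans (metric_triangle _ (V 1%g) _) _.
by rewrite lerD// metric_sym.
Qed.

(** The vertices of a bounded set lie in a word ball around any one of them, and such balls are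
    finite. *)
Lemma bounded_vertices (P : set X) :
  metric_bounded P -> finite_set [set g | P (V g)].
Proof.
move=> /metric_boundedP[r Pr].
have [->//|/set0P[g Pg]] := eqVneq [set g | P (V g)] set0.
have r0 : 0 <= r := le_trans (mdist_ge0 _ _) (Pr _ _ Pg Pg).
have := ltW (archi_boundP r0); set n := Num.bound r => rn.
apply: sub_finite_set (finite_image (fun h => g * h)%g
  (finite_word_ball (val : S -> G) n)) => h Ph.
exists (g^-1 * h)%g; last by rewrite mulVKg.
by apply: vertex_dist_ge; apply: le_trans (Pr _ _ Pg Ph) rn.
Qed.

(** Removing the empty set must leave an unbounded component, but every point is within [1] of a
    vertex, so a finite group has a bounded graph. *)
Lemma one_ended_infinite : one_ended X -> infinite_set [set: G].
Proof.
move=> /(_ set0)[]; first by apply/metric_boundedP; exists 0 => p q [].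
move=> C [[_ Cunb] _] Gfin; apply/Cunb/(near_finite_bounded Gfin) => p _.
by exists (base p).
Qed.

(* The full subgraph spanned by A is removed, not just its vertices: the
   remaining points are those where the interpolation below is nonzero. *)
Let subgraph (A : set G) : set X := fun p =>
  match p with
  | Vertex x => A x
  | Interior x s _ => A x /\ A (x * val s)%g
  end.

Let adj := cayley_adj (ball1 1).

Let subgraph_bounded A : finite_set A -> metric_bounded (subgraph A).
Proof.
move=> Afin; apply: (near_finite_bounded Afin) => p Ap.
by exists (base p) => //; case: p Ap => [//|x s t []].
Qed.

Let linked_component A x y : linked adj (~` A) x y ->
  connected_component (~` subgraph A) (V x) (V y).
Proof.
elim=> [z Az|u v w Au uv vw]; first exact: connected_component_refl.
apply: connected_component_trans.
have edge g (s : S) : ~ A g -> ~ A (g * val s)%g ->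
    connected_component (~` subgraph A) (V g) (V (g * val s)%g).
  move=> Ag Ags; exists ((fun t : R => edge_point g s t : X) @` `[0, 1]).
    split; last exact: edge_connected.
      by exists 0; rewrite ?edge_point0//= in_itv/= lexx ler01.
    move=> _ [t /= t01 <-]; rewrite in_itv/= in t01.
    by have [[_ ->]|[_ ->]|[z _ ->]] := edge_pointP g s t01 => //= -[].
  by exists 1; rewrite ?edge_point1//= in_itv/= lexx ler01.
(* The adjacency is given by the empty word, so that [v = u], or by one letter; an inverse letter is
   an edge traversed backwards. *)
case: uv => -[|[s b] [|//]] _.
  rewrite word_eval_nil => E.
  have -> : v = u by rewrite -[v](mulVKg u) -E mulg1.
  exact: connected_component_refl.
rewrite word_eval1 /letter_eval/= => E; have Av := linked_l vw.
have vE : v = (u * if b then (val s)^-1 else val s)%g by rewrite E mulVKg.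
case: b vE {E} => vE; last by rewrite vE; apply: edge => //; rewrite -vE.
apply: connected_component_sym.
have -> : u = (v * val s)%g by rewrite vE mulgVK.
by apply: edge => //; rewrite vE mulgVK.
Qed.

Let component_linked A x y : ~ A x ->
  connected_component (~` subgraph A) (V x) (V y) -> linked adj (~` A) x y.
Proof.
move=> Ax xy; pose W := [set z | linked adj (~` A) x z].
(* The sign of [h] separates [W] from the other vertices outside [A]. No edge joins these two kinds,
   so [h] jumps by at most [1] and its interpolation vanishes only on [subgraph A]; a connected set
   off [subgraph A] keeps its sign. *)
pose h z : R := if `[< A z >] then 0 else if `[< W z >] then 1 else -1.
have hcross u v : adj u v -> W u -> ~ A v -> W v.
  by move=> uv Wu Av; apply: linked_trans Wu (linked1 (linked_r Wu) Av uv).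
have hP z : [\/ A z /\ h z = 0, [/\ ~ A z, W z & h z = 1] |
    [/\ ~ A z, ~ W z & h z = -1]].
  rewrite /h; case: asboolP => Az; first exact: Or31.
  by case: asboolP => Wz; [exact: Or32|exact: Or33].
have hedge z (s : S) : W z -> ~ A (z * val s)%g -> W (z * val s)%g.
  apply: hcross; rewrite /adj /cayley_adj mulKg.
  exact: (word_ball_letter (val : S -> G) 0 (s, false)).
have hedgeV z (s : S) : W (z * val s)%g -> ~ A z -> W z.
  apply: hcross; rewrite /adj /cayley_adj invgM mulgVK.
  exact: (word_ball_letter (val : S -> G) 0 (s, true)).
have hlip z (s : S) : `|h (z * val s)%g - h z| <= 1.
  rewrite ler_norml.
  by have [[_ ->]|[Az Wz ->]|[Az Wz ->]] := hP z;
    have [[_ ->]|[Azs Wzs ->]|[Azs Wzs ->]] := hP (z * val s)%g;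
    apply/andP; split; try lra; exfalso;
    first [exact: (Wzs (hedge _ _ Wz Azs)) | exact: (Wz (hedgeV _ _ Wzs Az))].
have h1 : 0 < interpolate h (V x).
  by rewrite /= /h asboolF// asboolT//; exact: linked_refl.
suff : 0 < interpolate h (V y).
  rewrite /= /h; case: asboolP; first by rewrite ltxx.
  by case: asboolP => // _ _; rewrite ltr0N1.
move: h1; apply: (lipschitz_connected_gt0 (interpolate_lip hlip)
  (@component_connected _ (~` subgraph A) (V x))) => //; last first.
  by apply: connected_component_refl.
move=> p /connected_component_sub; case: p => [z|z s t] /=.
  by have [[]|[_ _ ->]|[_ _ ->]] := hP z => //; rewrite ?oppr_eq0 oner_eq0.
have /andP[t0 t1] : 0 < sval t < 1 := valP t.
move=> Ap; apply/eqP.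
have [[Az ->]|[Az Wz ->]|[Az Wz ->]] := hP z;
  have [[Azs ->]|[Azs Wzs ->]|[Azs Wzs ->]] := hP (z * val s)%g.
- by case: Ap.
all: move=> ?; try lra.
- exact: (Wzs (hedge _ _ Wz Azs)).
- exact: (Wz (hedgeV _ _ Wzs Az)).
Qed.

(** [F] consists of [A] and the finite components of its complement. By connectedness of the graph
    each of these has a vertex next to [A], so they are finitely many; one-endedness allows only one
    infinite component. *)
Lemma one_ended_coconn (A : set G) : one_ended X -> finite_set A -> A !=set0 ->
  exists2 F, finite_set F &
    forall x y, ~ F x -> ~ F y -> linked adj (~` A) x y.
Proof.
move=> X1 Afin [a0 Aa0].
pose W x := [set y | linked adj (~` A) x y].
have adj_sym := @cayley_adj_sym _ _ (val : S -> G) 1.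
pose D := [set (a * g)%g | a in A & g in ball1 1] `&`
  [set x | finite_set (W x)].
have Dfin : finite_set D.
  apply/finite_setIl/finite_image2 => //; exact: finite_word_ball.
exists (A `|` \bigcup_(x in D) W x).
  by rewrite finite_setU; split=> //; apply: bigcup_finite => // x [].
have Wlarge x : ~ (A `|` \bigcup_(x in D) W x) x -> ~ A x /\ infinite_set (W x).
  move=> /not_orP[Ax Dx]; split=> // Wfin; apply: Dx.
  have [u [v [xu _ uv Wu Wv]]] : exists u v,
      [/\ linked adj setT x u, setT v, adj u v, W x u & ~ W x v].
    apply: linked_cross (cayley_linked x a0 genS (ltn0Sn 0)) _ _.
      exact: linked_refl.
    by move=> xa; exact: (linked_r xa) Aa0.
  have Av : A v.
    apply: contrapT => Av; apply: Wv.
    exact: linked_trans Wu (linked1 (linked_r Wu) Av uv).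
  have ux : linked adj (~` A) u x := linked_sym adj_sym Wu.
  exists u => //; split.
    by exists v => //; exists (v^-1 * u)%g; [exact: adj_sym|rewrite mulVKg].
  apply: sub_finite_set Wfin => z; exact: linked_trans.
move=> x y /Wlarge[Ax Wx] /Wlarge[Ay Wy].
have [C [_ Cuniq]] := X1 _ (subgraph_bounded Afin).
(* An infinite class puts infinitely many vertices into one topological component, which is then
   unbounded and equals [C]. *)
have unb z : ~ A z -> infinite_set (W z) ->
    C = connected_component (~` subgraph A) (V z).
  move=> Az Wz; apply: Cuniq; split; first by exists (V z).
  move=> /bounded_vertices Cfin; apply: Wz; apply: sub_finite_set Cfin => t.
  exact: linked_component.
apply: component_linked => //; rewrite -(unb x)// (unb y)//.
exact: connected_component_refl.
Qed.

End cayley_graph_geometry.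

(** * Asymptotic dimension *)

Lemma asdim_ge2 (R : realType) (X : metricType R) :
  ~ asdim_cover X 1 -> (2%:E <= asdim X)%E.
Proof.
move=> X1; rewrite /asdim; case: pselect => [h|_]; last exact: leey.
case: ex_minnP => m /asboolP Xm _; rewrite lee_fin ler_nat ltnNge.
(* From a cover by a single set, use that set twice. *)
apply/negP; case: m Xm => [|[|//]] Xm _; apply: X1 => // d d0.
have [Y [XY Yd]] := Xm d d0; exists (fun=> Y ord0); split=> //.
rewrite XY; apply/seteqP; split=> x [i _ Yx]; exists ord0 => //.
by rewrite (ord1 i) in Yx.
Qed.

(* The metric graph is only used through the word metric of S; the relators
   are short for the word metric of the generators f of the presentation. *)
Lemma one_ended_not_asdim_cover1 (R : realType) (G : groupType) (S : {fset G})
    (genS : generates (val : S -> G)) :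
  finitely_presented G -> one_ended (cayley_graph R genS) ->
  ~ asdim_cover (cayley_graph R genS) 1.
Proof.
move=> [n [f [rels [genf pres]]]] X1 cover.
have [m Sm] := word_ball_bounded genf (finite_word_ball (val : S -> G) 1).
(* [2] serves the cancelling pairs, the maximum over [rels] the relators, and [m] makes neighbours
   for [S] adjacent. *)
pose M := maxn 2 (maxn (\max_(r <- rels) size r) m).
have SM : word_ball (val : S -> G) 1 `<=` word_ball f M.
  move=> g /Sm; apply: word_ballS.
  by rewrite leq_max leq_maxr orbT.
have relM : {in rels, forall r, size r <= M}%N.
  by move=> r rr; rewrite !leq_max (leq_bigmax_seq r rr isT) orbT.
pose adj := cayley_adj (word_ball f M).
have [k Mk] := word_ball_bounded genS (finite_word_ball f M).
pose V g : cayley_graph R genS := Vertex R S g.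
have adj_dist x y : adj x y -> mdist (V x) (V y) < k.+1%:R.
  move=> /Mk/(vertex_dist_le (R := R) genS) xy.
  by apply: le_lt_trans xy _; rewrite ltr_nat.
(* Neighbours for [adj] are strictly less than [k.+1] apart, so at this scale a monochromatic path
   stays in one piece of one [Y i]. *)
have [Y [XY Yd]] := cover k.+1%:R (ltr0Sn _ _).
have [r rP] := choice (fun i => d_disconnected_linked (Yd i)).
pose b := (\sum_i Num.bound `|r i|)%N.
have rb i : r i <= b%:R.
  apply: le_trans (ler_norm _) (le_trans (ltW (archi_boundP (normr_ge0 _))) _).
  by rewrite ler_nat /b (bigD1 i)//= leq_addr.
pose col g := `[< Y ord0 (V g) >].
have colP g : Y (if col g then ord0 else ord_max) (V g).
  rewrite /col; case: asboolP => // nY0.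
  have [i _ Yi] : (\bigcup_i Y i) (V g) by rewrite -XY.
  have -> // : ord_max = i.
  apply/val_inj; case: i Yi => [[|[|//]] i2] //.
  by rewrite (_ : Ordinal i2 = ord0)//; exact/val_inj.
have monoB x y : linked adj [set z | col z = col x] x y ->
    word_ball (val : S -> G) b (x^-1 * y)%g.
  move=> xy; apply: (vertex_dist_ge (R := R) (genS := genS)).
  apply: le_trans (rb (if col x then ord0 else ord_max)).
  apply: rP; apply: linked_map xy => [u v /adj_dist//|u /= <-].
  exact: colP.
(* One-endedness is applied to the ball around [1]; left translates of [F] then serve every [x] with
   the same bound on their size. *)
have [||F Ffin Flk] := one_ended_coconn (A := word_ball (val : S -> G) b) X1.
- exact: finite_word_ball.
- by exists 1%g; exact: word_ball1.
apply: (@no_bounded_2coloring G adj col #|` fset_set F|).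
- exact: cayley_adj_sym.
- by move=> x y; apply: cayley_linked => //; rewrite leq_max.
- by apply: (presentation_cocycles_trivial genf pres _ relM); exact: leq_maxl.
- exact: one_ended_infinite X1.
move=> x; exists [fset (x * g)%g | g in fset_set F]%fset; split.
  exact: leq_imfset_card.
have xF y : y \notin [fset (x * g)%g | g in fset_set F]%fset ->
    ~ F (x^-1 * y)%g.
  move=> /negP yF Fy; apply: yF; apply/imfsetP; exists (x^-1 * y)%g.
    by rewrite /= in_fset_set// inE.
  by rewrite mulVKg.
(* After translation by [x] the path avoids the ball around [x], which contains the monochromatic
   component of [x], and its edges are edges of [adj] by [SM]. *)
move=> y z /xF yF /xF zF; have := linked_mul x (Flk _ _ yF zF).
rewrite !mulVKg; apply: linked_sub => [u v /SM//|u /= + /monoB].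
exact.
Qed.

Theorem theorem1 (R : realType) (G : groupType) (S : {fset G})
    (genS : generates (val : S -> G)) :
  finitely_presented G ->
  one_ended (cayley_graph R genS) ->
  (2%:E <= asdim (cayley_graph R genS))%E.
Proof.
by move=> Gfp X1; apply: asdim_ge2; exact: one_ended_not_asdim_cover1.
Qed.
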